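(* Let $H, W$ be positive integers, and let $\bm{A}^1, \dots, \bm{A}^H \in \mathbb{R}^{W \times W}$ and $\bm{B}^1, \dots, \bm{B}^W \in \mathbb{R}^{H \times H}$ be arbitrary matrices. Let $\bm{M}^A, \bm{M}^B \in \mathbb{R}^{HW \times HW}$ be $\bm{M}^A = \mathrm{unfold}(\bm{\mathcal{M}}^A)$ and $\bm{M}^B = \mathrm{unfold}(\bm{\mathcal{M}}^B)$, where for $1 \le i,k \le H$ and $1 \le j,l \le W$ $$\bm{\mathcal{M}}^A_{i,j,k,l} = \begin{cases} [\bm{A}^i]_{j,l} & k = i \\ 0 & k \ne i \end{cases}, \qquad \bm{\mathcal{M}}^B_{i,j,k,l} = \begin{cases} [\bm{B}^l]_{i,k} & j = l \\ 0 & j \ne l \end{cases}.$$ Then for all $\bm{x}, \bm{y} \in \mathbb{R}^{HW}$, with $\bm{X} = \mathrm{unvec}(\bm{x}) \in \mathbb{R}^{H \times W}$ and $\bm{Y} = \mathrm{unvec}(\bm{y}) \in \mathbb{R}^{H \times W}$, one has $$\bm{y} = \bm{M}^A \times \bm{M}^B \times \bm{x}$$ if and only if $$\bm{Y}_{i,:} = \bm{A}^i \times \bm{Z}_{i,:} \quad \text{for all } i = 1, \dots, H,$$ where $\bm{Z} \in \mathbb{R}^{H \times W}$ is the matrix defined by $\bm{Z}_{:,l} = \bm{B}^l \times \bm{X}_{:,l}$ for all $l = 1, \dots, W$.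
   Context: For a 4D tensor $\bm{\mathcal{T}} \in \mathbb{R}^{H \times W \times H \times W}$, $\mathrm{unfold}(\bm{\mathcal{T}}) \in \mathbb{R}^{HW \times HW}$ is the matrix with entries $[\mathrm{unfold}(\bm{\mathcal{T}})]_{(i-1)W + j,\ (k-1)W + l} = \bm{\mathcal{T}}_{i,j,k,l}$ for $1 \le i,k \le H$, $1 \le j,l \le W$. For $\bm{x} \in \mathbb{R}^{HW}$, $\mathrm{unvec}(\bm{x}) \in \mathbb{R}^{H \times W}$ is the matrix with $[\mathrm{unvec}(\bm{x})]_{i,j} = \bm{x}_{(i-1)W+j}$. $\bm{X}_{:,l}$ denotes the $l$-th column of $\bm{X}$, regarded as a vector in $\mathbb{R}^H$; $\bm{Z}_{i,:}$ denotes the $i$-th row of $\bm{Z}$, regarded as a (column) vector in $\mathbb{R}^W$. The symbol $\times$ denotes matrix multiplication. *)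

(* Defs.v *)
(* Libraries: MathComp, with the reals as an arbitrary realType of
   MathComp-Analysis. *)
From mathcomp Require Import all_boot all_order all_algebra.
From mathcomp Require Import reals.

Set Implicit Arguments.
Unset Strict Implicit.
Unset Printing Implicit Defensive.

Import GRing.Theory.
Local Open Scope ring_scope.

(* Indices are 0-based: the position (i-1)W + j of a 1-based pair (i, j)
   becomes i * W + j. *)
Lemma flat_idx_proof (H W : nat) (i : 'I_H) (j : 'I_W) :
  (i * W + j < H * W)%N.
Proof.
by apply: leq_trans (leq_mul (ltn_ord i) (leqnn W)); rewrite mulSn addnC ltn_add2r.
Qed.

Definition flat_idx (H W : nat) (i : 'I_H) (j : 'I_W) : 'I_(H * W) :=
  Ordinal (flat_idx_proof i j).

Lemma flat_row_proof (H W : nat) (p : 'I_(H * W)) : (p %/ W < H)%N.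
Proof.
by case: W p => [|W] p; [case: p; rewrite muln0 | rewrite ltn_divLR].
Qed.

Lemma flat_col_proof (H W : nat) (p : 'I_(H * W)) : (p %% W < W)%N.
Proof.
by case: W p => [|W] p; [case: p; rewrite muln0 | rewrite ltn_mod].
Qed.

Definition flat_row (H W : nat) (p : 'I_(H * W)) : 'I_H :=
  Ordinal (flat_row_proof p).
Definition flat_col (H W : nat) (p : 'I_(H * W)) : 'I_W :=
  Ordinal (flat_col_proof p).

Lemma flat_idxK1 (H W : nat) (i : 'I_H) (j : 'I_W) :
  flat_row (flat_idx i j) = i.
Proof.
have W_gt0 : (0 < W)%N by apply: leq_ltn_trans (ltn_ord j).
by apply: val_inj; rewrite /= divnMDl // divn_small ?addn0.
Qed.

Lemma flat_idxK2 (H W : nat) (i : 'I_H) (j : 'I_W) :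
  flat_col (flat_idx i j) = j.
Proof. by apply: val_inj; rewrite /= modnMDl modn_small. Qed.

Definition tensor4 (R : Type) (H W : nat) : Type :=
  'I_H -> 'I_W -> 'I_H -> 'I_W -> R.

Definition unfold (R : Type) (H W : nat) (T : tensor4 R H W) :
    'M[R]_(H * W) :=
  \matrix_(p, q) T (flat_row p) (flat_col p) (flat_row q) (flat_col q).

Lemma unfoldE (R : Type) (H W : nat) (T : tensor4 R H W)
    (i k : 'I_H) (j l : 'I_W) :
  unfold T (flat_idx i j) (flat_idx k l) = T i j k l.
Proof. by rewrite mxE !flat_idxK1 !flat_idxK2. Qed.

Definition unvec (R : Type) (H W : nat) (x : 'cV[R]_(H * W)) : 'M[R]_(H, W) :=
  \matrix_(i, j) x (flat_idx i j) ord0.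

Definition tensorA (R : realType) (H W : nat) (A : 'I_H -> 'M[R]_W) :
    tensor4 R H W :=
  fun i j k l => if k == i then A i j l else 0.

Definition tensorB (R : realType) (H W : nat) (B : 'I_W -> 'M[R]_H) :
    tensor4 R H W :=
  fun i j k l => if j == l then B l i k else 0.

(* Main.v *)
Require Import Defs.
From mathcomp Require Import all_boot all_order all_algebra.
From mathcomp Require Import reals.

Local Open Scope ring_scope.

Import GRing.Theory.

(** Seen through [unvec], multiplication by [unfold T] contracts the last two indices of [T] against
    a matrix ([unvec_mul_unfold]). The Kronecker delta in [tensorB] makes this contraction act on
    each column [l] by [B l], and the one in [tensorA] on each row [i] by [A i]. Hence [Z] is forced
    to be [unvec (MB *m x)], and the row equations say that [y] and [MA *m (MB *m x)] have the same
    [unvec], which is injective. *)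

Lemma flat_idxK (H W : nat) (p : 'I_(H * W)) :
  flat_idx (flat_row p) (flat_col p) = p.
Proof. by apply: val_inj; rewrite /= -divn_eq. Qed.

(** Reindexing along the bijection [flat_idx], whose inverse is Euclidean division by [W]. *)
Lemma sum_flat_idx (V : nmodType) (H W : nat) (F : 'I_(H * W) -> V) :
  \sum_p F p = \sum_(k < H) \sum_(l < W) F (flat_idx k l).
Proof.
rewrite pair_big /=; apply: (reindex (fun kl => flat_idx kl.1 kl.2)) => /=.
exists (fun p => (flat_row p, flat_col p)) => [[k l]|p] _ /=.
  by rewrite flat_idxK1 flat_idxK2.
exact: flat_idxK.
Qed.

Lemma unvec_inj (T : Type) (H W : nat) : injective (@unvec T H W).
Proof.
move=> x y /matrixP exy; apply/colP => p.
by have := exy (flat_row p) (flat_col p); rewrite !mxE flat_idxK.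
Qed.

Lemma unvec_mul_unfold (R : pzSemiRingType) (H W : nat) (T : tensor4 R H W)
    (x : 'cV[R]_(H * W)) (i : 'I_H) (j : 'I_W) :
  unvec (unfold T *m x) i j = \sum_k \sum_l T i j k l * unvec x k l.
Proof.
rewrite mxE mxE sum_flat_idx.
by apply: eq_bigr => k _; apply: eq_bigr => l _; rewrite unfoldE mxE.
Qed.

(** The delta kills the outer sum except at [k = i]; the remaining sum over [l] is a product with
    [A i]. *)
Lemma row_unvec_tensorA (R : realType) (H W : nat) (A : 'I_H -> 'M[R]_W)
    (x : 'cV[R]_(H * W)) (i : 'I_H) :
  (row i (unvec (unfold (tensorA A) *m x)))^T = A i *m (row i (unvec x))^T.
Proof.
apply/colP => j; rewrite [LHS]mxE [LHS]mxE unvec_mul_unfold [RHS]mxE.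
rewrite (bigD1 i) //= [X in _ + X]big1 ?addr0 => [|k /negPf ki].
  by apply: eq_bigr => l _; rewrite /tensorA eqxx !mxE.
by apply: big1 => l _; rewrite /tensorA ki mul0r.
Qed.

(** Here the delta collapses the inner sum instead, so the sum over the row index [k] survives. *)
Lemma col_unvec_tensorB (R : realType) (H W : nat) (B : 'I_W -> 'M[R]_H)
    (x : 'cV[R]_(H * W)) (l : 'I_W) :
  col l (unvec (unfold (tensorB B) *m x)) = B l *m col l (unvec x).
Proof.
apply/colP => i; rewrite [LHS]mxE unvec_mul_unfold [RHS]mxE.
apply: eq_bigr => k _; rewrite (bigD1 l) //= big1 ?addr0 => [|j jl].
  by rewrite /tensorB eqxx !mxE.
by rewrite /tensorB eq_sym (negPf jl) mul0r.
Qed.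

Theorem theorem2 (R : realType) (H W : nat) (hH : (0 < H)%N) (hW : (0 < W)%N)
    (A : 'I_H -> 'M[R]_W) (B : 'I_W -> 'M[R]_H) :
  let MA : 'M[R]_(H * W) := unfold (tensorA A) in
  let MB : 'M[R]_(H * W) := unfold (tensorB B) in
  forall x y : 'cV[R]_(H * W),
  let X : 'M[R]_(H, W) := unvec x in
  let Y : 'M[R]_(H, W) := unvec y in
  forall Z : 'M[R]_(H, W),
  (forall l : 'I_W, col l Z = B l *m col l X) ->
  (y = MA *m MB *m x <->
   forall i : 'I_H, (row i Y)^T = A i *m (row i Z)^T).
Proof.
move=> MA MB x y X Y Z ZE.
(* A matrix is determined by its columns. *)
have {ZE} -> : Z = unvec (MB *m x).
  by apply/matrixP => i l; have /colP/(_ i) := ZE l;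
     rewrite -col_unvec_tensorB mxE [RHS]mxE.
rewrite -mulmxA {}/Y; split => [-> i|YE]; first exact: row_unvec_tensorA.
(* Equality of vectors is reduced to equality of the transposed rows, the form in which [YE] is
   stated. *)
apply/unvec_inj/row_matrixP => i; apply: trmx_inj.
by rewrite row_unvec_tensorA -YE.
Qed.
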